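(* Let $\mathcal{L}:\mathcal{M}_d\to\mathcal{M}_d$ be a doubly stochastic and primitive Liouvillian with spectral gap $\lambda$, and let $\|\frac{\mathcal{L}+\mathcal{L}^*}{2}\|$ be the operator norm of its additive symmetrization. Then for any $n\in\mathbb{N}$, $$\Big\|\frac{\mathcal{L}+\mathcal{L}^*}{2}\Big\|\,\alpha_2(\mathcal{L}_{\text{dep}}^{(n)})\geq\alpha_2(\mathcal{L}^{(n)})\geq\lambda\,\alpha_2(\mathcal{L}_{\text{dep}}^{(n)}).$$
   Context: $\mathcal{M}_D$: complex $D\times D$ matrices; $\mathcal{M}_D^+$: positive definite ones. A Liouvillian is the generator $\mathcal{L}$ of a quantum dynamical semigroup $T_t=e^{t\mathcal{L}}$ (continuous semigroup of completely positive trace-preserving maps, $T_0=\text{id}$). $\mathcal{L}^*$ is the adjoint w.r.t. the Hilbert–Schmidt inner product $\langle X,Y\rangle=\text{tr}(X^\dagger Y)$; the operator norm is w.r.t. this inner product. $\mathcal{L}$ is doubly stochastic if $\mathcal{L}(\mathbb{1}_d)=0$ (i.e. $\mathbb{1}_d/d$ is a fixed point) and primitive if $\lim_{t\to\infty}T_t(\rho)=\mathbb{1}_d/d$ for all density matrices $\rho$. The depolarizing Liouvillian is $\mathcal{L}_{\text{dep}}(X)=\text{tr}(X)\frac{\mathbb{1}_d}{d}-X$. For a Liouvillian $\mathcal{L}$ on $\mathcal{M}_d$, $\mathcal{L}^{(n)}=\sum_{i=1}^n\text{id}_d^{\otimes(i-1)}\otimes\mathcal{L}\otimes\text{id}_d^{\otimes(n-i)}$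 on $\mathcal{M}_{d^n}$. For a doubly stochastic Liouvillian on $\mathcal{M}_D$: Dirichlet form $\mathcal{E}^2_{\mathcal{L}}(X)=-\frac1D\text{tr}[\mathcal{L}(X)X]$; $\text{Ent}_2(X)=\frac{1}{2D}\text{tr}[X^2(\log\frac{X^2}{\text{tr}(X^2)}+\log D)]$; LS-2 constant $\alpha_2(\mathcal{L})=\inf_{X\in\mathcal{M}_D^+}\mathcal{E}^2_{\mathcal{L}}(X)/\text{Ent}_2(X)$; spectral gap $\lambda(\mathcal{L})=\inf\mathcal{E}^2_{\mathcal{L}}(X)/\text{Var}(X)$ over Hermitian $X$ not proportional to $\mathbb{1}$, with $\text{Var}(X)=\frac1D\text{tr}[(X-\text{tr}(X)\frac{\mathbb{1}}{D})^2]$. *)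

(* Defs.v *)
From HB Require Import structures.
From mathcomp Require Import all_boot all_order all_algebra.
From mathcomp Require Import complex.
From mathcomp Require Import boolp classical_sets reals topology normedtype sequences exp.
From Stdlib Require Import ClassicalEpsilon.

Set Implicit Arguments.
Unset Strict Implicit.
Unset Printing Implicit Defensive.

Import Order.TTheory GRing.Theory Num.Theory.
Import numFieldNormedType.Exports.
Local Open Scope ring_scope.
Local Open Scope classical_set_scope.

Section Matrices.
Variables (R : realType) (I : finType).
Local Notation C := R[i].

Definition mat := I -> I -> C.
Definition superop := mat -> mat.

Definition mzero : mat := fun _ _ => 0.
Definition mone : mat := fun i j => (i == j)%:R.
Definition munit (i j : I) : mat := fun k l => ((k == i) && (l == j))%:R.
Definition madd (A B : mat) : mat := fun i j => A i j + B i j.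
Definition mscale (c : C) (A : mat) : mat := fun i j => c * A i j.
Definition mmul (A B : mat) : mat := fun i j => \sum_k A i k * B k j.
Definition mtr (A : mat) : C := \sum_i A i i.
Definition madj (A : mat) : mat := fun i j => conjc (A j i).
Definition mdiag (v : I -> C) : mat := fun i j => (i == j)%:R * v i.

Definition dimD : R := #|I|%:R.

Definition hs (A B : mat) : C := mtr (mmul (madj A) B).

Definition hermitian (A : mat) := forall i j, A i j = conjc (A j i).
Definition qform (A : mat) (v : I -> C) : C :=
  \sum_i \sum_j conjc (v i) * A i j * v j.
Definition psd (A : mat) := hermitian A /\ forall v, 0 <= qform A v.
Definition posdef (A : mat) :=
  hermitian A /\ forall v : I -> C, (exists i, v i != 0) -> 0 < qform A v.
Definition density (rho : mat) := psd rho /\ mtr rho = 1.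
Definition propto_id (X : mat) := exists c : C, X = mscale c mone.
Definition unitary (U : mat) := mmul (madj U) U = mone.

Definition spec_decomp (A : mat) (p : mat * (I -> R)) :=
  unitary p.1 /\ A = mmul (mmul p.1 (mdiag (fun i => (p.2 i)%:C%C))) (madj p.1).
Definition mfun (f : R -> R) (A : mat) : mat :=
  let p := epsilon (inhabits (mzero, fun _ => 0)) (spec_decomp A) in
  mmul (mmul p.1 (mdiag (fun i => (f (p.2 i))%:C%C))) (madj p.1).
Definition mlog (A : mat) : mat := mfun (@ln R) A.

Definition linear_so (T : superop) :=
  forall (c : C) (A B : mat), T (madd (mscale c A) B) = madd (mscale c (T A)) (T B).

(* Hilbert--Schmidt adjoint:  <X, L Y> = <L^* X, Y> *)
Definition so_adj (L : superop) : superop :=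
  fun X i j => \sum_k \sum_l conjc (L (munit i j) k l) * X k l.

Definition so_add (L M : superop) : superop := fun X => madd (L X) (M X).
Definition so_symm (L : superop) : superop :=
  fun X => mscale (2^-1)%:C%C (so_add L (so_adj L) X).

Definition hsnorm (A : mat) : R := Num.sqrt (complex.Re (hs A A)).
Definition opnorm (S : superop) : R :=
  sup [set r | exists X : mat, X <> mzero /\ r = hsnorm (S X) / hsnorm X].

Definition exp_partial (L : superop) (t : R) (X : mat) (i j : I) (N : nat) : C :=
  \sum_(k < N) ((t ^+ k / (k`!)%:R)%:C%C * iter k L X i j).
Definition exp_so (L : superop) (t : R) : superop :=
  fun X i j => Complex (limn (fun N => complex.Re (exp_partial L t X i j N)))
                       (limn (fun N => complex.Im (exp_partial L t X i j N))).

Definition trace_preserving (T : superop) := forall X, mtr (T X) = mtr X.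

Definition doubly_stochastic (L : superop) := L mone = mzero.

Definition primitive (L : superop) :=
  forall rho, density rho -> forall i j,
    (complex.Re (exp_so L t rho i j) @[t --> +oo] --> complex.Re (mscale (dimD^-1)%:C%C mone i j)) /\
    (complex.Im (exp_so L t rho i j) @[t --> +oo] --> complex.Im (mscale (dimD^-1)%:C%C mone i j)).

Definition dirichlet (L : superop) (X : mat) : R :=
  - complex.Re (mtr (mmul (L X) X)) / dimD.
Definition ent2 (X : mat) : R :=
  let X2 := mmul X X in
  complex.Re (mtr (mmul X2 (madd (mlog (mscale (mtr X2)^-1 X2))
                         (mscale (@ln R dimD)%:C%C mone)))) / (2 * dimD).
Definition variance (X : mat) : R :=
  let Y := madd X (mscale (- (mtr X / dimD%:C%C)) mone) in
  complex.Re (mtr (mmul Y Y)) / dimD.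

Definition alpha2 (L : superop) : R :=
  inf [set r | exists X : mat, posdef X /\ ~ propto_id X /\
                               r = dirichlet L X / ent2 X].
Definition spectral_gap (L : superop) : R :=
  inf [set r | exists X : mat, hermitian X /\ ~ propto_id X /\
                               r = dirichlet L X / variance X].

Definition Ldep : superop :=
  fun X => madd (mscale (mtr X / dimD%:C%C) mone) (mscale (-1) X).

End Matrices.

(* complete positivity: id_k (x) T maps PSD to PSD for every k *)
Definition completely_positive (R : realType) (I : finType) (T : superop R I) :=
  forall (k : nat) (Y : mat R ('I_k * I)%type), psd Y ->
    psd (fun (a b : ('I_k * I)%type) =>
           T (fun i j => Y (a.1, i) (b.1, j)) a.2 b.2).

Definition liouvillian (R : realType) (I : finType) (L : superop R I) :=
  linear_so L /\
  forall t : R, 0 <= t ->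
    completely_positive (exp_so L t) /\ trace_preserving (exp_so L t).

(* n-fold tensor power: M_{d^n} = M_d^{(x) n}, indexed by {ffun 'I_n -> 'I_d} *)
Definition upd (n d : nat) (a : {ffun 'I_n -> 'I_d}) (s : 'I_n) (p : 'I_d) :
  {ffun 'I_n -> 'I_d} := [ffun j => if j == s then p else a j].

(* id^{(x)(s)} (x) L (x) id^{(x)(n-s-1)} *)
Definition on_site (R : realType) (n d : nat) (L : superop R 'I_d) (s : 'I_n)
  : superop R {ffun 'I_n -> 'I_d} :=
  fun X a b => L (fun p q => X (upd a s p) (upd b s q)) (a s) (b s).

Definition ampl (R : realType) (n d : nat) (L : superop R 'I_d)
  : superop R {ffun 'I_n -> 'I_d} :=
  fun X a b => \sum_(s < n) on_site L s X a b.
Arguments ampl {R} n {d} L.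
Arguments Ldep {R} I.

(* Main.v *)
(* The form [- Re <Y, L Y>] is compared with [- Re <Y, Ldep Y>], the squared norm
   of the traceless part of [Y], for every (not necessarily Hermitian) [Y] in
   [M_d].  The upper bound is Cauchy--Schwarz on the traceless part.  For the lower
   bound split [Y = A + iB] with [A], [B] Hermitian: [L] preserves adjoints, so
   the cross terms vanish and the gap inequality applies to [A] and [B].  On [n]
   sites the Dirichlet form of Hermitian [X] is, up to a positive factor, the sum
   of the one-site forms over the blocks [Y] of [X] with all other sites frozen,
   so both bounds lift to [M_(d^n)], and dividing by [Ent_2 >= 0] compares the
   infima.  Since [inf] is 0 on a set that is not bounded below,
   [0 <= - tr (L(X) X)] for Hermitian [X] is also needed; it comes from complete
   positivity of [exp (tL)] at first order in [t]. *)
Require Import Defs.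
From HB Require Import structures.
From mathcomp Require Import all_boot all_order all_algebra.
From mathcomp Require Import complex.
From mathcomp Require Import boolp classical_sets reals topology normedtype sequences exp.
From mathcomp Require Import ring lra.
From Stdlib Require Import ClassicalEpsilon.
Import Order.TTheory GRing.Theory Num.Theory.
Import numFieldNormedType.Exports.
Local Open Scope ring_scope.

Set Implicit Arguments.
Unset Strict Implicit.
Unset Printing Implicit Defensive.

(** * First-order terms at t = 0 *)

(** For [k >= 2] and [t] in [[0, 1]] one has [t ^+ k <= t ^+ 2], so the tail of the series is at
    most [t ^+ 2] times the exponential series of [K], scaled by [M]. It is meant for [a k] an entry
    of [L^k X]. *)
Lemma exp_series_remainder (R : realType) (a : nat -> R) (M K t : R) :
  0 <= K -> (forall k, `|a k| <= M * K ^+ k) -> 0 <= t <= 1 ->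
  `|limn (fun N => \sum_(k < N) (t ^+ k / (k`!)%:R * a k)) - (a 0 + t * a 1)|
    <= M * expR K * t ^+ 2.
Proof.
move=> K0 aM /andP[t0 t1].
have M0 : 0 <= M by have := le_trans (normr_ge0 _) (aM 0%N); rewrite expr0 mulr1.
pose u k := t ^+ k / (k`!)%:R * a k.
have -> : (fun N => \sum_(k < N) (t ^+ k / (k`!)%:R * a k)) = series u.
  by apply/funext => N; rewrite /series /= big_mkord.
have ub k : `|u k| <= t ^+ k * (M * exp_coeff K k).
  rewrite /u !normrM normrX (ger0_norm t0) -mulrA ler_wpM2l ?exprn_ge0 //.
  by rewrite normfV (ger0_norm (ler0n _ _)) /exp_coeff /= mulrC mulrA ler_wpM2r ?invr_ge0.
have e0 k : 0 <= exp_coeff K k by apply: exp_coeff_ge0.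
have eK N : series (exp_coeff K) N <= expR K.
  apply: nondecreasing_cvgn_le; last exact: is_cvg_series_exp_coeff.
  by apply/nondecreasing_seqP => n; rewrite /series /= big_nat_recr //= lerDl.
have cu : cvgn (series u).
  apply: normed_cvg.
  apply: (@series_le_cvg _ _ (fun k => M * exp_coeff K k)).
  - by move=> k; apply: normr_ge0.
  - by move=> k; apply: mulr_ge0.
  - move=> k; apply: le_trans (ub k) _.
    by apply: ler_piMl; [rewrite mulr_ge0|rewrite exprn_ile1].
  - have := @is_cvg_seriesZ _ _ M (is_cvg_series_exp_coeff K); exact.
(* Every partial sum containing the first two terms already obeys the bound, which then passes to
   the limit. *)
have tail N : (2 <= N)%N -> `|series u N - (a 0 + t * a 1)| <= M * expR K * t ^+ 2.
  move=> N2; rewrite /series /= (big_ltn (ltnW N2)) (big_ltn N2).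
  rewrite {1 2}/u fact0 expr0 expr1 !divr1 mul1r.
  rewrite (_ : _ - _ = \sum_(2 <= i < N) u i); last by ring.
  apply: le_trans (ler_norm_sum _ _ _) _.
  apply: (@le_trans _ _ (\sum_(2 <= i < N) M * t ^+ 2 * exp_coeff K i)).
    rewrite big_nat_cond [X in _ <= X]big_nat_cond; apply: ler_sum => i /andP[/andP[i2 _] _].
    apply: le_trans (ub i) _; rewrite mulrA [t ^+ i * M]mulrC ler_wpM2r ?ler_wpM2l //.
    by rewrite -(subnKC i2) exprD ler_piMr ?exprn_ge0 // exprn_ile1.
  rewrite -mulr_sumr [M * expR K * _]mulrAC ler_wpM2l ?mulr_ge0 ?exprn_ge0 //.
  apply: le_trans (eK N); rewrite /series /= (big_ltn (ltnW N2)) (big_ltn N2).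
  by rewrite addrA lerDr addr_ge0.
rewrite ler_distl; apply/andP; split.
  by apply: (limr_ge cu); exists 2%N => // N /= /tail; rewrite ler_distl => /andP[].
by apply: (limr_le cu); exists 2%N => // N /= /tail; rewrite ler_distl => /andP[].
Qed.

Lemma linear_term_ge0 (R : realType) (c K : R) : 0 <= K ->
  (forall t, 0 <= t <= 1 -> 0 <= t * c + K * t ^+ 2) -> 0 <= c.
Proof.
move=> K0 h; rewrite leNgt; apply/negP => c0.
(* This [t] lies in []0, 1]] and is small enough for the slope to win: [c + K * t = c * (1 - c) / (K
   + 1 - c) < 0]. *)
pose t := - c / (K + 1 - c).
have dgt : 0 < K + 1 - c by lra.
have tgt : 0 < t by rewrite divr_gt0 // oppr_gt0.
have tle : t <= 1 by rewrite ler_pdivrMr // mul1r; lra.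
have := h t; rewrite (ltW tgt) tle => /(_ isT).
rewrite (_ : _ + _ = t * (c + K * t)); last by ring.
rewrite pmulr_rge0 //.
have -> : c + K * t = c * (1 - c) / (K + 1 - c) by rewrite /t; field; rewrite gt_eqF.
by rewrite leNgt ltr_pdivrMr // mul0r nmulr_rlt0 //; lra.
Qed.

Lemma linear_term_eq0 (R : realType) (c K : R) : 0 <= K ->
  (forall t, 0 <= t <= 1 -> `|t * c| <= K * t ^+ 2) -> c = 0.
Proof.
move=> K0 h; apply/eqP; rewrite eq_le; apply/andP; split.
  rewrite -oppr_ge0; apply: (linear_term_ge0 K0) => t t01.
  by have := h t t01; rewrite ler_norml => /andP[]; lra.
apply: (linear_term_ge0 K0) => t t01.
by have := h t t01; rewrite ler_norml => /andP[]; lra.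
Qed.

(** * Real Hilbert-Schmidt geometry *)

Section Superoperators.
Variables (R : realType) (I : finType).
Local Notation C := R[i].
Local Notation mat := (mat R I).
Local Notation superop := (superop R I).
Local Notation Re := complex.Re.
Local Notation Im := complex.Im.
Local Notation hermitian := (@Defs.hermitian R I).
Local Notation mzero := (@mzero R I).
Local Notation mone := (@mone R I).
Local Notation munit := (@munit R I).
Local Notation normc := Normc.normc.

Lemma cReD (x y : C) : Re (x + y) = Re x + Re y.
Proof. by case: x y => [a b] [c e]. Qed.
Lemma cImD (x y : C) : Im (x + y) = Im x + Im y.
Proof. by case: x y => [a b] [c e]. Qed.
Lemma cReM (x y : C) : Re (x * y) = Re x * Re y - Im x * Im y.
Proof. by case: x y => [a b] [c e]. Qed.
Lemma cImM (x y : C) : Im (x * y) = Re x * Im y + Im x * Re y.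
Proof. by case: x y => [a b] [c e]. Qed.
Lemma cReJ (x : C) : Re (conjc x) = Re x. Proof. by case: x. Qed.
Lemma cImJ (x : C) : Im (conjc x) = - Im x. Proof. by case: x. Qed.
Lemma conjcD (x y : C) : conjc (x + y) = conjc x + conjc y.
Proof. exact: rmorphD. Qed.
Lemma conjcN (x : C) : conjc (- x) = - conjc x. Proof. exact: rmorphN. Qed.
Lemma conjcM (x y : C) : conjc (x * y) = conjc x * conjc y.
Proof. exact: rmorphM. Qed.
Lemma Re_sum (J : Type) (r : seq J) (P : pred J) (F : J -> C) :
  Re (\sum_(j <- r | P j) F j) = \sum_(j <- r | P j) Re (F j).
Proof. by elim/big_rec2: _ => // j x y _ <-; rewrite cReD. Qed.
Lemma Im_sum (J : Type) (r : seq J) (P : pred J) (F : J -> C) :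
  Im (\sum_(j <- r | P j) F j) = \sum_(j <- r | P j) Im (F j).
Proof. by elim/big_rec2: _ => // j x y _ <-; rewrite cImD. Qed.

Lemma mat_ext (A B : mat) : (forall i j, A i j = B i j) -> A = B.
Proof. by move=> h; apply/funext => i; apply/funext => j. Qed.

Lemma complex_ext (x y : C) : Re x = Re y -> Im x = Im y -> x = y.
Proof. by case: x y => [a b] [c e] /= -> ->. Qed.

Lemma mmulA (A B D : mat) : mmul A (mmul B D) = mmul (mmul A B) D.
Proof.
apply: mat_ext => i j; rewrite /mmul.
under eq_bigr do rewrite mulr_sumr.
rewrite exchange_big; apply: eq_bigr => k _ /=.
by rewrite mulr_suml; apply: eq_bigr => l _; rewrite mulrA.
Qed.

Lemma mmul1m (A : mat) : mmul mone A = A.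
Proof.
apply: mat_ext => i j; rewrite /mmul (bigD1 i) //= big1 ?addr0 => [|m mi].
  by rewrite /Defs.mone eqxx mul1r.
by rewrite /Defs.mone eq_sym (negPf mi) mul0r.
Qed.

Lemma mmulm1 (A : mat) : mmul A mone = A.
Proof.
apply: mat_ext => i j; rewrite /mmul (bigD1 j) //= big1 ?addr0 => [|m mj].
  by rewrite /Defs.mone eqxx mulr1.
by rewrite /Defs.mone (negPf mj) mulr0.
Qed.

Lemma mtrC (A B : mat) : mtr (mmul A B) = mtr (mmul B A).
Proof.
rewrite /mtr /mmul exchange_big; apply: eq_bigr => i _; apply: eq_bigr => j _.
exact: mulrC.
Qed.

Lemma mmulZl c (A B : mat) : mmul (mscale c A) B = mscale c (mmul A B).
Proof.
apply: mat_ext => i j; rewrite /mmul /mscale mulr_sumr.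
by apply: eq_bigr => k _; rewrite mulrA.
Qed.

Lemma mmulZr c (A B : mat) : mmul A (mscale c B) = mscale c (mmul A B).
Proof.
apply: mat_ext => i j; rewrite /mmul /mscale mulr_sumr.
by apply: eq_bigr => k _; rewrite mulrCA.
Qed.

Lemma mmulDr (A B D : mat) : mmul A (madd B D) = madd (mmul A B) (mmul A D).
Proof.
apply: mat_ext => i j; rewrite /mmul /madd -big_split.
by apply: eq_bigr => k _; rewrite mulrDr.
Qed.

Lemma mtrD (A B : mat) : mtr (madd A B) = mtr A + mtr B.
Proof. by rewrite -big_split. Qed.

Lemma mtrZ c (A : mat) : mtr (mscale c A) = c * mtr A.
Proof. by rewrite /mtr mulr_sumr. Qed.

Lemma mtr_mone : mtr mone = (dimD R I)%:C%C.
Proof.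
rewrite /mtr /Defs.mone /dimD rmorph_nat.
under eq_bigr do rewrite eqxx.
by rewrite sumr_const.
Qed.

Lemma madjD (A B : mat) : madj (madd A B) = madd (madj A) (madj B).
Proof. by apply: mat_ext => i j; rewrite /madj /madd rmorphD. Qed.
Lemma madjZ c (A : mat) : madj (mscale c A) = mscale (conjc c) (madj A).
Proof. by apply: mat_ext => i j; rewrite /madj /mscale rmorphM. Qed.
Lemma madjK (A : mat) : madj (madj A) = A.
Proof. by apply: mat_ext => i j; rewrite /madj conjcK. Qed.

Lemma mtr_madj (A : mat) : mtr (madj A) = conjc (mtr A).
Proof. by rewrite rmorph_sum. Qed.

Lemma madj_mone : madj mone = mone.
Proof.
apply: mat_ext => i j; rewrite /madj /Defs.mone eq_sym.
by case: (i == j); rewrite ?conjc1 ?conjc0.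
Qed.

(** The real part of the Hilbert-Schmidt inner product. It makes the matrices a real Euclidean
    space, so that all estimates stay in [R]. *)
Definition rip (A B : mat) : R :=
  \sum_i \sum_j (Re (A i j) * Re (B i j) + Im (A i j) * Im (B i j)).

Lemma ripE A B : rip A B = Re (\sum_i \sum_j A i j * conjc (B i j)).
Proof.
rewrite Re_sum; apply: eq_bigr => i _; rewrite Re_sum; apply: eq_bigr => j _.
by rewrite cReM cReJ cImJ mulrN opprK.
Qed.

Lemma ripC A B : rip A B = rip B A.
Proof. by apply: eq_bigr => i _; apply: eq_bigr => j _; ring. Qed.

Lemma ripDl A B D : rip (madd A B) D = rip A D + rip B D.
Proof.
rewrite -big_split; apply: eq_bigr => i _; rewrite -big_split.
by apply: eq_bigr => j _; rewrite /= /madd cReD cImD; ring.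
Qed.

Lemma ripDr A B D : rip D (madd A B) = rip D A + rip D B.
Proof. by rewrite ripC ripDl !(ripC _ D). Qed.

Lemma ripZl (c : R) A B : rip (mscale c%:C%C A) B = c * rip A B.
Proof.
rewrite mulr_sumr; apply: eq_bigr => i _; rewrite mulr_sumr.
by apply: eq_bigr => j _; rewrite /mscale cReM cImM /=; ring.
Qed.

Lemma ripZr (c : R) A B : rip A (mscale c%:C%C B) = c * rip A B.
Proof. by rewrite ripC ripZl ripC. Qed.

Lemma mscaleN1 (A : mat) : mscale (-1) A = mscale (-1)%:C%C A.
Proof. by congr mscale; apply/eqP; rewrite eq_complex /= oppr0 !eqxx. Qed.

Lemma rip_ge0 A : 0 <= rip A A.
Proof.
apply: sumr_ge0 => i _; apply: sumr_ge0 => j _.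
by rewrite addr_ge0 // -expr2 sqr_ge0.
Qed.

Lemma rip_eq0 A : rip A A = 0 -> A = mzero.
Proof.
move=> A0; apply: mat_ext => i j.
have ge k l : 0 <= Re (A k l) * Re (A k l) + Im (A k l) * Im (A k l).
  by rewrite addr_ge0 // -expr2 sqr_ge0.
move/eqP: A0; rewrite psumr_eq0; last by move=> k _; apply: sumr_ge0.
move=> /allP /(_ i (mem_index_enum _)) /=.
rewrite psumr_eq0 // => /allP /(_ j (mem_index_enum _)) /=.
rewrite paddr_eq0 -?expr2 ?sqr_ge0 // !sqrf_eq0 => /andP[/eqP a /eqP b].
exact: complex_ext.
Qed.

Lemma rip0l A : rip mzero A = 0.
Proof. by rewrite /rip big1 // => i _; rewrite big1 // => j _; rewrite /= !mul0r addr0. Qed.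

Lemma rip_CauchySchwarz A B : rip A B ^+ 2 <= rip A A * rip B B.
Proof.
have [B0|Bn0] := eqVneq (rip B B) 0.
  have -> : rip A B = 0 by rewrite (rip_eq0 B0) ripC rip0l.
  by rewrite expr0n mulr_ge0 ?rip_ge0.
have Bgt : 0 < rip B B by rewrite lt_neqAle eq_sym Bn0 rip_ge0.
(* The squared norm of [<B,B> A - <A,B> B] is [<B,B> (<A,A> <B,B> - <A,B>^2)]. *)
have := rip_ge0 (madd (mscale (rip B B)%:C%C A) (mscale (- rip A B)%:C%C B)).
rewrite !(ripDl, ripDr) !(ripZl, ripZr) (ripC B A) => h.
by rewrite -subr_ge0 -(pmulr_rge0 _ Bgt); apply: le_trans h _; lra.
Qed.

Lemma hsnormE A : hsnorm A = Num.sqrt (rip A A).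
Proof.
rewrite /hsnorm ripE /hs /mtr /mmul /madj exchange_big /=; congr (Num.sqrt (Re _)).
by apply: eq_bigr => i _; apply: eq_bigr => j _; rewrite mulrC.
Qed.

Lemma sqr_hsnorm A : hsnorm A ^+ 2 = rip A A.
Proof. by rewrite hsnormE sqr_sqrtr // rip_ge0. Qed.

Lemma norm_rip_le A B : `|rip A B| <= hsnorm A * hsnorm B.
Proof.
rewrite !hsnormE -sqrtrM ?rip_ge0 //.
by rewrite -sqrtr_sqr ler_sqrt ?mulr_ge0 ?rip_ge0 // rip_CauchySchwarz.
Qed.

Lemma rip_adj A B : rip (madj A) (madj B) = rip A B.
Proof.
rewrite /rip exchange_big; apply: eq_bigr => i _; apply: eq_bigr => j _ /=.
by rewrite /madj !cReJ !cImJ mulrNN.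
Qed.

Lemma rip_i A B : rip (mscale 'i%C A) (mscale 'i%C B) = rip A B.
Proof.
apply: eq_bigr => i _; apply: eq_bigr => j _ /=.
by rewrite /mscale !cReM !cImM /=; ring.
Qed.

Lemma hermitian_adj (A : mat) : hermitian A <-> madj A = A.
Proof.
split=> [h|h i j]; first by apply: mat_ext => i j; rewrite /madj -h.
by rewrite -{1}h.
Qed.

Lemma rip_mone A (c : C) : rip A (mscale c mone) = Re (mtr A * conjc c).
Proof.
rewrite ripE; congr Re; rewrite /mtr mulr_suml; apply: eq_bigr => i _.
rewrite (bigD1 i) //= big1 ?addr0 => [|j ji]; first by rewrite /mscale /mone eqxx mulr1.
by rewrite /mscale /mone eq_sym (negPf ji) mulr0 conjc0 mulr0.
Qed.

Lemma Re_trmul_hermitian A B : hermitian B -> Re (mtr (mmul A B)) = rip A B.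
Proof.
move=> hB; rewrite ripE; congr Re; apply: eq_bigr => i _; apply: eq_bigr => k _.
by rewrite (hB k i).
Qed.

Lemma lin_add (T : superop) A B : linear_so T -> T (madd A B) = madd (T A) (T B).
Proof.
move=> lT; rewrite -[LHS](_ : T (madd (mscale 1 A) B) = _).
  by rewrite lT; apply: mat_ext => i j; rewrite /madd /mscale mul1r.
by congr T; apply: mat_ext => i j; rewrite /madd /mscale mul1r.
Qed.

Lemma lin0 (T : superop) : linear_so T -> T mzero = mzero.
Proof.
move=> lT; have := lT (-1) mzero mzero.
rewrite (_ : madd _ _ = mzero); last first.
  by apply: mat_ext => i j; rewrite /madd /mscale /mzero mulr0 addr0.
by move=> ->; apply: mat_ext => i j; rewrite /madd /mscale mulN1r addNr.
Qed.

Lemma lin_scale (T : superop) (c : C) A : linear_so T -> T (mscale c A) = mscale c (T A).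
Proof.
move=> lT; have := lT c A mzero; rewrite (lin0 lT) => E.
rewrite (_ : mscale c A = madd (mscale c A) mzero); last first.
  by apply: mat_ext => i j; rewrite /madd /mzero addr0.
by rewrite E; apply: mat_ext => i j; rewrite /madd /mzero addr0.
Qed.

Lemma lin_sum (T : superop) (J : Type) (r : seq J) (F : J -> mat) : linear_so T ->
  forall i j, T (fun k l => \sum_(x <- r) F x k l) i j = \sum_(x <- r) T (F x) i j.
Proof.
move=> lT; elim: r => [|x r IH] i j.
  rewrite big_nil (_ : (fun _ _ => _) = mzero) ?lin0 //.
  by apply: mat_ext => k l; rewrite big_nil.
rewrite big_cons -IH (_ : (fun _ _ => _) = madd (F x) (fun k l => \sum_(x <- r) F x k l)).
  by rewrite lin_add.
by apply: mat_ext => k l; rewrite big_cons.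
Qed.

Lemma lin_munit (T : superop) X i j : linear_so T ->
  T X i j = \sum_k \sum_l X k l * T (munit k l) i j.
Proof.
move=> lT.
rewrite [in LHS](_ : X = fun a b => \sum_k \sum_l mscale (X k l) (munit k l) a b).
  rewrite lin_sum //; apply: eq_bigr => k _; rewrite lin_sum //.
  by apply: eq_bigr => l _; rewrite lin_scale.
apply: mat_ext => a b; rewrite (bigD1 a) //= (bigD1 b) //= /mscale /munit !eqxx mulr1.
rewrite big1 => [|l lb]; last by rewrite eq_sym (negPf lb) mulr0.
rewrite big1 => [|k ka]; last by rewrite big1 // => l _; rewrite eq_sym (negPf ka) mulr0.
by rewrite !addr0.
Qed.

Lemma rip_so_adj (L : superop) X : linear_so L -> rip (so_adj L X) X = rip (L X) X.
Proof.
move=> lL; rewrite [RHS]ripC !ripE; congr Re; rewrite /so_adj.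
under eq_bigr => i _ do under eq_bigr => j _ do rewrite mulr_suml.
under eq_bigr => i _ do rewrite exchange_big /=.
rewrite exchange_big /=; apply: eq_bigr => k _.
under eq_bigr => i _ do under eq_bigr => j _ do rewrite mulr_suml.
under eq_bigr => i _ do rewrite exchange_big /=.
rewrite exchange_big /=; apply: eq_bigr => l _.
rewrite (lin_munit X k l lL) rmorph_sum mulr_sumr; apply: eq_bigr => i _.
rewrite rmorph_sum mulr_sumr; apply: eq_bigr => j _.
rewrite rmorphM /=; ring.
Qed.

(** [L] and its adjoint have the same real quadratic form, hence so does their mean. This is how the
    additive symmetrization enters the upper bound. *)
Lemma rip_so_symm (L : superop) X : linear_so L -> rip (so_symm L X) X = rip (L X) X.
Proof.
move=> lL; rewrite /so_symm ripZl /so_add ripDl rip_so_adj //; lra.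
Qed.

(** * Entrywise norm bounds and finiteness of the operator norm *)

Lemma normc_ge0 (x : C) : 0 <= normc x.
Proof. by case: x => a b; apply: sqrtr_ge0. Qed.

Lemma normc_sqr (x : C) : normc x ^+ 2 = Re x ^+ 2 + Im x ^+ 2.
Proof. by case: x => a b /=; rewrite sqr_sqrtr // addr_ge0 ?sqr_ge0. Qed.

Lemma Re_le_normc (x : C) : `|Re x| <= normc x.
Proof.
case: x => a b /=; rewrite -sqrtr_sqr ler_sqrt ?addr_ge0 ?sqr_ge0 //.
by rewrite lerDl sqr_ge0.
Qed.

Lemma Im_le_normc (x : C) : `|Im x| <= normc x.
Proof.
case: x => a b /=; rewrite -sqrtr_sqr ler_sqrt ?addr_ge0 ?sqr_ge0 //.
by rewrite lerDr sqr_ge0.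
Qed.

Lemma normc_sum (J : Type) (r : seq J) (F : J -> C) :
  normc (\sum_(j <- r) F j) <= \sum_(j <- r) normc (F j).
Proof.
elim: r => [|j r IH]; first by rewrite !big_nil Normc.normc0.
by rewrite !big_cons; apply: le_trans (le_normcD _ _) _; rewrite lerD2l.
Qed.

Definition l1norm (X : mat) : R := \sum_i \sum_j normc (X i j).

Lemma l1norm_ge0 X : 0 <= l1norm X.
Proof. by apply: sumr_ge0 => i _; apply: sumr_ge0 => j _; apply: normc_ge0. Qed.

Lemma entry_le_l1norm X i j : normc (X i j) <= l1norm X.
Proof.
rewrite /l1norm (bigD1 i) //= (bigD1 j) //= -addrA lerDl addr_ge0 //.
  by apply: sumr_ge0 => k _; apply: normc_ge0.
by apply: sumr_ge0 => k _; apply: sumr_ge0 => l _; apply: normc_ge0.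
Qed.

Definition l1bound (T : superop) : R := \sum_k \sum_l l1norm (T (munit k l)).

Lemma l1bound_ge0 T : 0 <= l1bound T.
Proof. by apply: sumr_ge0 => i _; apply: sumr_ge0 => j _; apply: l1norm_ge0. Qed.

(** Expand [T X] over the matrix units and bound each coefficient of [X] by its whole norm. The
    estimate serves both the powers of [L] in the exponential and the finiteness of [opnorm]. *)
Lemma l1norm_lin (T : superop) X : linear_so T -> l1norm (T X) <= l1bound T * l1norm X.
Proof.
move=> lT.
apply: (@le_trans _ _ (\sum_i \sum_j \sum_k \sum_l l1norm X * normc (T (munit k l) i j))).
  apply: ler_sum => i _; apply: ler_sum => j _; rewrite (lin_munit X i j lT).
  apply: le_trans (normc_sum _ _) _; apply: ler_sum => k _.
  apply: le_trans (normc_sum _ _) _; apply: ler_sum => l _.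
  by rewrite Normc.normcM ler_wpM2r ?normc_ge0 ?entry_le_l1norm.
rewrite le_eqVlt; apply/orP; left; apply/eqP.
under eq_bigr => i _ do rewrite exchange_big /=.
rewrite exchange_big /= mulr_suml; apply: eq_bigr => k _.
under eq_bigr => i _ do rewrite exchange_big /=.
rewrite exchange_big /= mulr_suml; apply: eq_bigr => l _.
rewrite mulrC mulr_sumr; apply: eq_bigr => i _.
by rewrite mulr_sumr.
Qed.

Lemma ripxx (X : mat) : rip X X = \sum_i \sum_j normc (X i j) ^+ 2.
Proof. by apply: eq_bigr => i _; apply: eq_bigr => j _; rewrite normc_sqr. Qed.

Lemma entry_le_hsnorm (X : mat) i j : normc (X i j) <= hsnorm X.
Proof.
rewrite hsnormE -(ger0_norm (normc_ge0 _)) -sqrtr_sqr ler_sqrt ?rip_ge0 // ripxx.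
rewrite (bigD1 i) //= (bigD1 j) //= -addrA lerDl addr_ge0 //.
  by apply: sumr_ge0 => k _; apply: sqr_ge0.
by apply: sumr_ge0 => k _; apply: sumr_ge0 => l _; apply: sqr_ge0.
Qed.

Lemma hsnorm_le_l1norm (X : mat) : hsnorm X <= l1norm X.
Proof.
rewrite hsnormE -(ger0_norm (l1norm_ge0 _)) -sqrtr_sqr ler_sqrt ?sqr_ge0 // ripxx.
rewrite expr2 {1}/l1norm mulr_suml; apply: ler_sum => i _.
rewrite mulr_suml; apply: ler_sum => j _.
by rewrite expr2 ler_wpM2l ?normc_ge0 ?entry_le_l1norm.
Qed.

Lemma l1norm_le_hsnorm (X : mat) : l1norm X <= #|I|%:R ^+ 2 * hsnorm X.
Proof.
apply: (@le_trans _ _ (\sum_(i : I) \sum_(j : I) hsnorm X)).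
  by apply: ler_sum => i _; apply: ler_sum => j _; apply: entry_le_hsnorm.
by rewrite !sumr_const -mulrnA -natrX mulr_natl expnS expn1.
Qed.

(** All norms are equivalent in finite dimension, here [hsnorm] and [l1norm]. Boundedness is what
    lets the [sup] in [opnorm] dominate each quotient. *)
Lemma opnorm_has_ub (T : superop) : linear_so T ->
  has_ubound [set r | exists X : mat, X <> mzero /\ r = hsnorm (T X) / hsnorm X]%classic.
Proof.
move=> lT; exists (l1bound T * #|I|%:R ^+ 2) => _ [X [X0 ->]].
have [->|Xn] := eqVneq (hsnorm X) 0.
  by rewrite invr0 mulr0 mulr_ge0 ?sqr_ge0 ?l1bound_ge0.
have Xgt : 0 < hsnorm X by rewrite lt_neqAle eq_sym Xn sqrtr_ge0.
rewrite ler_pdivrMr // -mulrA; apply: le_trans (hsnorm_le_l1norm _) _.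
by apply: le_trans (l1norm_lin _ lT) _; rewrite ler_wpM2l ?l1bound_ge0 ?l1norm_le_hsnorm.
Qed.

Lemma hsnorm0 (X : mat) : hsnorm X = 0 -> X = mzero.
Proof. by move=> X0; apply: rip_eq0; rewrite -sqr_hsnorm X0 expr0n. Qed.

Lemma hsnorm_le_opnorm (T : superop) X : linear_so T -> hsnorm (T X) <= opnorm T * hsnorm X.
Proof.
move=> lT; have [/hsnorm0 ->|Xn] := eqVneq (hsnorm X) 0.
  by rewrite (lin0 lT) !hsnormE rip0l sqrtr0 mulr0.
have Xgt : 0 < hsnorm X by rewrite lt_neqAle eq_sym Xn sqrtr_ge0.
rewrite -ler_pdivrMr //; apply: (ub_le_sup (opnorm_has_ub lT)).
by exists X; split=> // X0; move: Xn; rewrite hsnormE X0 rip0l sqrtr0 eqxx.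
Qed.

Lemma so_symm_linear (L : superop) : linear_so L -> linear_so (so_symm L).
Proof.
move=> lL c A B; apply: mat_ext => i j.
rewrite /so_symm /so_add /so_adj lL /madd /mscale.
rewrite (_ : \sum_k \sum_l _ = c * (\sum_k \sum_l conjc (L (munit i j) k l) * A k l)
   + \sum_k \sum_l conjc (L (munit i j) k l) * B k l); first by ring.
rewrite mulr_sumr -big_split; apply: eq_bigr => k _ /=.
rewrite mulr_sumr -big_split; apply: eq_bigr => l _ /=; ring.
Qed.

Lemma rip_so_symm_le (L : superop) X : linear_so L ->
  - rip (L X) X <= opnorm (so_symm L) * rip X X.
Proof.
move=> lL; rewrite -rip_so_symm //; apply: le_trans (ler_norm _) _.
rewrite normrN; apply: le_trans (norm_rip_le _ _) _.
rewrite -sqr_hsnorm expr2 mulrA ler_wpM2r ?sqrtr_ge0 //.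
exact/hsnorm_le_opnorm/so_symm_linear.
Qed.

Lemma dimD_ge0 : 0 <= dimD R I.
Proof. exact: ler0n. Qed.

(** * Spectral gap and operator norm bounds on one site *)

Definition center (Y : mat) : mat :=
  madd Y (mscale (- (mtr Y / (dimD R I)%:C%C)) mone).

Lemma mtr_center Y : (0 < #|I|)%N -> mtr (center Y) = 0.
Proof.
move=> I0; rewrite mtrD mtrZ mtr_mone mulNr divfK ?subrr //.
by rewrite fmorph_eq0 /dimD pnatr_eq0 -lt0n.
Qed.

Lemma center_decomp Y :
  Y = madd (center Y) (mscale (mtr Y / (dimD R I)%:C%C) mone).
Proof. by apply: mat_ext => i j; rewrite /center /madd /mscale; ring. Qed.

(** [Ldep] is minus the orthogonal projection onto the traceless matrices. *)
Lemma rip_Ldep Y : (0 < #|I|)%N -> - rip (Ldep I Y) Y = rip (center Y) (center Y).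
Proof.
move=> I0; rewrite (_ : Ldep I Y = mscale (-1)%:C%C (center Y)).
  rewrite ripZl {2}[Y]center_decomp ripDr rip_mone mtr_center // mul0r.
  by rewrite /= addr0 mulN1r opprK.
rewrite -mscaleN1; apply: mat_ext => i j; rewrite /Ldep /center /madd /mscale; ring.
Qed.

(** The identity component of [Y] is killed by [L] in the first argument, and in the second it is
    orthogonal to the traceless image of [L]. *)
Lemma rip_center (L : superop) Y : linear_so L -> doubly_stochastic L ->
  (forall X, mtr (L X) = 0) -> rip (L (center Y)) (center Y) = rip (L Y) Y.
Proof.
move=> lL L1 trL; rewrite {3 4}[Y]center_decomp (lin_add _ _ lL) (lin_scale _ _ lL) L1.
rewrite (_ : madd (L _) _ = L (center Y)); last first.
  by apply: mat_ext => i j; rewrite /madd /mscale /Defs.mzero mulr0 addr0.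
by rewrite ripDr rip_mone trL mul0r addr0.
Qed.

Lemma rip_le_opnorm (L : superop) Y : (0 < #|I|)%N -> linear_so L ->
  doubly_stochastic L -> (forall X, mtr (L X) = 0) ->
  - rip (L Y) Y <= opnorm (so_symm L) * - rip (Ldep I Y) Y.
Proof.
by move=> I0 lL L1 trL; rewrite rip_Ldep // -rip_center //; apply: rip_so_symm_le.
Qed.

Lemma dirichletE (L : superop) X : hermitian X ->
  dirichlet L X = - rip (L X) X / dimD R I.
Proof. by move=> hX; rewrite /dirichlet Re_trmul_hermitian. Qed.

Lemma hermitian_mtr X : hermitian X -> conjc (mtr X) = mtr X.
Proof. by move=> hX; rewrite rmorph_sum; apply: eq_bigr => i _; rewrite [RHS]hX. Qed.

Lemma hermitian_center X : hermitian X -> hermitian (center X).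
Proof.
move=> hX i j; rewrite /center /madd /mscale conjcD conjcM conjcN conjcM.
rewrite conjc_inv hermitian_mtr // -hX conjc_real /Defs.mone eq_sym.
by case: (j == i); rewrite ?conjc1 ?conjc0.
Qed.

Lemma varianceE X : hermitian X ->
  variance X = rip (center X) (center X) / dimD R I.
Proof. by move=> hX; rewrite /variance Re_trmul_hermitian //; apply: hermitian_center. Qed.

Definition spectral_gap_set (L : superop) : set R :=
  [set r | exists X : mat, hermitian X /\ ~ propto_id X /\
                               r = dirichlet L X / variance X]%classic.

Lemma variance_ge0 (X : mat) : hermitian X -> 0 <= variance X.
Proof. by move=> hX; rewrite varianceE // divr_ge0 ?rip_ge0 ?dimD_ge0. Qed.

(** * Hermitian and anti-Hermitian parts *)

Definition herm_part (Y : mat) : mat := mscale (2^-1)%:C%C (madd Y (madj Y)).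
Definition skew_part (Y : mat) : mat :=
  mscale (2^-1)%:C%C (madd Y (mscale (-1) (madj Y))).
(** The factor [- 'i] makes this Hermitian: it is the [B] in [Y = A + iB]. *)
Definition imag_part (Y : mat) : mat := mscale (- 'i%C) (skew_part Y).

Lemma herm_skew Y : Y = madd (herm_part Y) (skew_part Y).
Proof.
apply: mat_ext => i j; rewrite /herm_part /skew_part /madd /mscale /madj.
by case: (Y i j) (Y j i) => [a b] [c e]; apply: complex_ext => /=; lra.
Qed.

Lemma madj_herm_part Y : madj (herm_part Y) = herm_part Y.
Proof.
rewrite /herm_part madjZ madjD madjK conjc_real.
by congr mscale; apply: mat_ext => i j; rewrite /madd addrC.
Qed.

Lemma madj_skew_part Y : madj (skew_part Y) = mscale (-1) (skew_part Y).
Proof.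
rewrite /skew_part madjZ madjD madjZ madjK conjc_real conjcN conjc1.
by apply: mat_ext => i j; rewrite /madd /mscale; ring.
Qed.

Lemma sqr_Ni : - 'i%C * 'i%C = 1 :> C.
Proof. by rewrite mulNr -expr2 sqr_i opprK. Qed.

Lemma skew_imag Y : skew_part Y = mscale 'i%C (imag_part Y).
Proof.
apply: mat_ext => i j; rewrite /imag_part /mscale mulrA.
by rewrite [_ * - _]mulrC sqr_Ni mul1r.
Qed.

Lemma hermitian_imag_part Y : hermitian (imag_part Y).
Proof.
apply/hermitian_adj; rewrite /imag_part madjZ madj_skew_part.
apply: mat_ext => i j; rewrite /mscale mulN1r mulrN -mulNr; congr (_ * _).
by apply: complex_ext; rewrite /= ?oppr0 ?opprK.
Qed.

(** Taking adjoints of both arguments preserves [rip], but here it also flips the sign. *)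
Lemma rip_herm_skew (A K : mat) :
  madj A = A -> madj K = mscale (-1) K -> rip A K = 0.
Proof.
by move=> hA hK; have := rip_adj A K; rewrite hA hK mscaleN1 ripZr; lra.
Qed.

Lemma rip_herm_split (T : superop) Y : linear_so T ->
  (forall X, T (madj X) = madj (T X)) ->
  rip (T Y) Y = rip (T (herm_part Y)) (herm_part Y) + rip (T (imag_part Y)) (imag_part Y).
Proof.
move=> lT hT; rewrite {1 2}[Y]herm_skew (lin_add _ _ lT) ripDl !ripDr.
have -> : rip (T (herm_part Y)) (skew_part Y) = 0.
  by apply: rip_herm_skew; rewrite ?madj_skew_part // -hT madj_herm_part.
have -> : rip (T (skew_part Y)) (herm_part Y) = 0.
  rewrite ripC; apply: rip_herm_skew; rewrite ?madj_herm_part //.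
  by rewrite -hT madj_skew_part (lin_scale _ _ lT).
by rewrite addr0 add0r {1 2}skew_imag (lin_scale _ _ lT) rip_i.
Qed.

Lemma Ldep_linear : linear_so (@Ldep R I).
Proof.
move=> c A B; apply: mat_ext => i j; rewrite /Ldep mtrD mtrZ /madd /mscale; ring.
Qed.

Lemma Ldep_madj (X : mat) : Ldep I (madj X) = madj (Ldep I X).
Proof.
rewrite /Ldep madjD !madjZ mtr_madj madj_mone conjcM conjc_inv conjc_real.
by rewrite conjcN conjc1.
Qed.

Section Gap.
Variable L : superop.
Hypotheses (I0 : (0 < #|I|)%N) (lL : linear_so L)
  (hL : forall X, L (madj X) = madj (L X))
  (L_ge0 : forall X, hermitian X -> 0 <= - rip (L X) X).

Lemma dirichlet_ge0 (X : mat) : hermitian X -> 0 <= dirichlet L X.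
Proof. by move=> hX; rewrite dirichletE // divr_ge0 ?L_ge0 ?dimD_ge0. Qed.

Lemma spectral_gap_lb : lbound (spectral_gap_set L) 0.
Proof.
by move=> _ [X [hX [_ ->]]]; rewrite divr_ge0 ?variance_ge0 ?dirichlet_ge0.
Qed.

Lemma spectral_gap_ge0 : 0 <= spectral_gap L.
Proof.
rewrite /spectral_gap -/(spectral_gap_set L).
(* The set is empty when [#|I| = 1], every matrix then being a multiple of the identity; its [inf]
   is 0 by convention. *)
have [->|/set0P ne] := eqVneq (spectral_gap_set L) set0; first by rewrite inf0.
exact: lb_le_inf ne spectral_gap_lb.
Qed.

Lemma gap_le_hermitian X : hermitian X ->
  spectral_gap L * - rip (Ldep I X) X <= - rip (L X) X.
Proof.
move=> hX; rewrite rip_Ldep //.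
(* Multiples of the identity are excluded from the infimum; for them the left side is 0. *)
have [c0|cn] := eqVneq (rip (center X) (center X)) 0; first by rewrite c0 mulr0 L_ge0.
have cgt : 0 < rip (center X) (center X) by rewrite lt_neqAle eq_sym cn rip_ge0.
rewrite -ler_pdivlMr //.
have Dn : dimD R I != 0 by rewrite /dimD pnatr_eq0 -lt0n.
have -> : - rip (L X) X / rip (center X) (center X) = dirichlet L X / variance X.
  rewrite dirichletE // varianceE // invf_div mulrA mulrAC; field.
  by rewrite cn Dn.
apply: ge_inf; first by exists 0; apply: spectral_gap_lb.
exists X; split=> //; split=> // -[c Xc]; move: cn; rewrite (_ : center X = mzero).
  by rewrite rip0l eqxx.
have Dc : (dimD R I)%:C%C != 0 by rewrite fmorph_eq0.
apply: mat_ext => i j; rewrite /center Xc mtrZ mtr_mone mulfK //.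
by rewrite /madd /mscale mulNr subrr.
Qed.

Lemma gap_le Y : spectral_gap L * - rip (Ldep I Y) Y <= - rip (L Y) Y.
Proof.
rewrite (rip_herm_split (T := Ldep I) Y Ldep_linear Ldep_madj).
rewrite (rip_herm_split Y lL hL) !opprD mulrDr lerD //; apply: gap_le_hermitian.
  exact/hermitian_adj/madj_herm_part.
exact: hermitian_imag_part.
Qed.

End Gap.

(** * First-order consequences of the semigroup properties *)

Lemma l1norm_iter (L : superop) X k : linear_so L ->
  l1norm (iter k L X) <= l1norm X * l1bound L ^+ k.
Proof.
move=> lL; elim: k => [|k IH]; first by rewrite expr0 mulr1.
rewrite iterS; apply: le_trans (l1norm_lin _ lL) _.
by rewrite exprS mulrCA ler_wpM2l ?l1bound_ge0.
Qed.

(** The entries of [L^k X] grow at most like [l1bound L ^+ k], so the series estimate applies to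
    real and imaginary parts, with one [K] for all entries and all [t]. *)
Lemma exp_so_remainder (L : superop) X : linear_so L ->
  exists2 K : R, 0 <= K & forall t i j, 0 <= t <= 1 ->
    `|Re (exp_so L t X i j) - (Re (X i j) + t * Re (L X i j))| <= K * t ^+ 2 /\
    `|Im (exp_so L t X i j) - (Im (X i j) + t * Im (L X i j))| <= K * t ^+ 2.
Proof.
move=> lL; exists (l1norm X * expR (l1bound L)).
  by rewrite mulr_ge0 ?l1norm_ge0 ?expR_ge0.
move=> t i j t01.
have step k : normc (iter k L X i j) <= l1norm X * l1bound L ^+ k.
  exact: le_trans (entry_le_l1norm _ _ _) (l1norm_iter X k lL).
split; rewrite /exp_so /=.
- rewrite (_ : (fun N => _) = fun N =>
    \sum_(k < N) (t ^+ k / (k`!)%:R * Re (iter k L X i j))); last first.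
    apply/funext => N; rewrite Re_sum; apply: eq_bigr => k _.
    by rewrite cReM /= mul0r subr0.
  apply: (@exp_series_remainder _ (fun k => Re (iter k L X i j))) => //.
    exact: l1bound_ge0.
  by move=> k; apply: le_trans (Re_le_normc _) (step k).
- rewrite (_ : (fun N => _) = fun N =>
    \sum_(k < N) (t ^+ k / (k`!)%:R * Im (iter k L X i j))); last first.
    apply/funext => N; rewrite Im_sum; apply: eq_bigr => k _.
    by rewrite cImM /= mul0r addr0.
  apply: (@exp_series_remainder _ (fun k => Im (iter k L X i j))) => //.
    exact: l1bound_ge0.
  by move=> k; apply: le_trans (Im_le_normc _) (step k).
Qed.

Lemma rip_exp_so_remainder (L : superop) (B G : mat) : linear_so L ->
  exists2 K : R, 0 <= K & forall t, 0 <= t <= 1 ->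
    `|rip (exp_so L t B) G - (rip B G + t * rip (L B) G)| <= K * t ^+ 2.
Proof.
move=> lL; have [K K0 hK] := exp_so_remainder B lL.
exists (\sum_i \sum_j (K * `|Re (G i j)| + K * `|Im (G i j)|)).
  by apply: sumr_ge0 => i _; apply: sumr_ge0 => j _; rewrite addr_ge0 ?mulr_ge0.
move=> t t01; have {hK} := fun i j => hK t i j t01.
move: (exp_so L t B) => A hK; rewrite /rip mulr_sumr -big_split -sumrB mulr_suml /=.
apply: le_trans (ler_norm_sum _ _ _) _; apply: ler_sum => i _.
rewrite mulr_sumr -big_split -sumrB mulr_suml /=.
apply: le_trans (ler_norm_sum _ _ _) _; apply: ler_sum => j _.
have [hR hI] := hK i j; set a := Re (A i j); set b := Im (A i j).
rewrite (_ : _ - _ = (a - (Re (B i j) + t * Re (L B i j))) * Re (G i j) +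
  (b - (Im (B i j) + t * Im (L B i j))) * Im (G i j)); last by ring.
apply: le_trans (ler_normD _ _) _; rewrite !normrM mulrDl.
by apply: lerD; rewrite mulrAC ler_wpM2r.
Qed.

(** Transfers identities from the semigroup to its generator: two expansions that agree up to order
    [t ^+ 2] have equal linear coefficients. *)
Lemma rip_first_order_eq (L : superop) (A B G H : mat) : linear_so L ->
  (forall t, 0 <= t <= 1 -> rip (exp_so L t A) G = rip (exp_so L t B) H) ->
  rip A G = rip B H -> rip (L A) G = rip (L B) H.
Proof.
move=> lL hT h0.
have [K K0 hK] := rip_exp_so_remainder A G lL.
have [M M0 hM] := rip_exp_so_remainder B H lL.
apply/eqP; rewrite -subr_eq0; apply/eqP.
apply: (@linear_term_eq0 _ _ (K + M)); first by rewrite addr_ge0.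
move=> t t01; move: (hK t t01) (hM t t01); rewrite hT // h0 !ler_norml.
by move=> /andP[? ?] /andP[? ?]; apply/andP; split; lra.
Qed.

Lemma rip_mone1 (A : mat) : rip A mone = Re (mtr A).
Proof.
rewrite (_ : mone = mscale 1 mone) ?rip_mone ?conjc1 ?mulr1 //.
by apply: mat_ext => i j; rewrite /mscale mul1r.
Qed.

Lemma mtr_generator (L : superop) : liouvillian L -> forall X, mtr (L X) = 0.
Proof.
move=> [lL LT].
have Re0 X : Re (mtr (L X)) = 0.
  have [K K0 hK] := rip_exp_so_remainder X mone lL.
  apply: (linear_term_eq0 K0) => t t01; rewrite -normrN; move: (hK t t01).
  rewrite !rip_mone1; have /andP[t0 _] := t01.
  by have [_ ->] := LT t t0; rewrite opprD addrA subrr add0r.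
move=> X; apply: complex_ext; first exact: Re0.
(* [rip] sees only real parts; the imaginary part of the trace is, up to sign, the real part
   obtained from [iX]. *)
have := Re0 (mscale 'i%C X); rewrite (lin_scale _ _ lL) mtrZ cReM /=; lra.
Qed.

(** * Complete positivity tested on two-by-two Gram blocks *)

Definition gram (M : 'I_2 -> mat) : Defs.mat R ('I_2 * I)%type :=
  fun p q => mmul (madj (M p.1)) (M q.1) p.2 q.2.

Lemma psd_gram M : psd (gram M).
Proof.
split=> [p q|v].
  rewrite rmorph_sum; apply: eq_bigr => k _.
  by rewrite /= conjcM /madj conjcK mulrC.
(* [w] is the vector [M_0 v_0 + M_1 v_1], whose squared norm is the quadratic form. *)
pose w k := \sum_q M q.1 k q.2 * v q.
rewrite (_ : qform _ _ = \sum_k conjc (w k) * w k).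
  by apply: sumr_ge0 => k _; rewrite mulrC mulcJ_ge0.
rewrite /qform /gram /mmul /w.
under eq_bigr => p _ do under eq_bigr => q _ do rewrite mulr_sumr mulr_suml.
under eq_bigr => p _ do rewrite exchange_big /=.
rewrite exchange_big /=; apply: eq_bigr => k _.
rewrite rmorph_sum mulr_suml; apply: eq_bigr => p _.
rewrite mulr_sumr; apply: eq_bigr => q _.
by rewrite /= conjcM /madj; ring.
Qed.

Definition block2 (A B : mat) (a : 'I_2) : mat := if a == ord0 then A else B.

Lemma exp_so_madj (L : superop) t X : liouvillian L -> 0 <= t ->
  exp_so L t (madj X) = madj (exp_so L t X).
Proof.
move=> [lL LT] t0; have [cp _] := LT t t0.
(* The Gram matrix of [(1, X)] has off-diagonal blocks [X] and its adjoint; its image is Hermitian,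
   which relates the images of these two blocks. *)
have [h _] := cp 2 _ (psd_gram (block2 mone X)).
apply: mat_ext => i j; have := h (ord_max, i) (ord0, j); rewrite /gram /block2 /=.
by rewrite mmulm1 madj_mone mmul1m => ->.
Qed.

Lemma rip_ext (A B : mat) : (forall G, rip A G = rip B G) -> A = B.
Proof.
move=> h; pose D := madd A (mscale (-1)%:C%C B).
have D0 : D = mzero by apply: rip_eq0; rewrite {1}/D ripDl ripZl h; lra.
apply: mat_ext => i j; have := congr1 (fun f : mat => f i j) D0.
rewrite /D -mscaleN1 /madd /mscale /Defs.mzero mulN1r => /eqP.
by rewrite subr_eq0 => /eqP.
Qed.

Lemma generator_madj (L : superop) X : liouvillian L -> L (madj X) = madj (L X).
Proof.
move=> LL; have [lL _] := LL; apply: rip_ext => G.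
rewrite -[RHS]rip_adj madjK; apply: rip_first_order_eq => // [t /andP[t0 _]|].
  by rewrite exp_so_madj // -[RHS]rip_adj madjK.
by rewrite -[RHS]rip_adj madjK.
Qed.

(** The positive semidefinite image of the Gram matrix is tested on the [m]-th columns of [N],
    stacked; summing over [m] produces the products of [N a] with the adjoint of [N b]. *)
Lemma rip_block_test (T : superop) (M N : 'I_2 -> mat) :
  completely_positive T ->
  0 <= \sum_a \sum_b rip (T (mmul (madj (M a)) (M b))) (mmul (N a) (madj (N b))).
Proof.
move=> cp; have [_ h] := cp 2 _ (psd_gram M).
have : 0 <= \sum_m Re (qform (fun a b : 'I_2 * I =>
    T (fun i j => gram M (a.1, i) (b.1, j)) a.2 b.2) (fun p => N p.1 p.2 m)).
  by apply: sumr_ge0 => m _; have := h (fun p => N p.1 p.2 m); rewrite lecE => /andP[].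
move=> /le_trans; apply; rewrite le_eqVlt; apply/orP; left; apply/eqP.
rewrite -Re_sum /qform exchange_big /=.
rewrite (eq_bigr (fun a => \sum_b Re (\sum_i \sum_j T (mmul (madj (M a)) (M b)) i j *
   conjc (mmul (N a) (madj (N b)) i j)))); last first.
  by move=> a _; apply: eq_bigr => b _; rewrite ripE.
under [RHS]eq_bigr do rewrite -Re_sum.
rewrite -[RHS]Re_sum; congr Re.
rewrite -(pair_bigA _ (fun a i => \sum_m \sum_q conjc (N a i m) *
   T (fun i0 j => gram M (a, i0) (q.1, j)) i q.2 * N q.1 q.2 m)) /=.
apply: eq_bigr => a _; rewrite [RHS]exchange_big /=; apply: eq_bigr => i _.
rewrite exchange_big /=.
rewrite -(pair_bigA _ (fun b j => \sum_m conjc (N a i m) *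
   T (fun i0 j => gram M (a, i0) (b, j)) i j * N b j m)) /=.
apply: eq_bigr => b _; apply: eq_bigr => j _.
rewrite rmorph_sum mulr_sumr; apply: eq_bigr => m _.
rewrite /= conjcM /madj conjcK /gram /=; ring.
Qed.

(* Complete positivity of [T = exp (tL)] on the Gram matrix of [(1, X)], tested
   on the columns of [(X, -1)], gives [2 tr (X T(X)) <= tr (T(1) X^2) + tr T(X^2)],
   an equality at [t = 0] whose first-order term in [t] is the claim. *)
Lemma generator_dissipative (L : superop) X : liouvillian L -> doubly_stochastic L ->
  hermitian X -> 0 <= - rip (L X) X.
Proof.
move=> LL L1 hX; have [lL LT] := LL; have /hermitian_adj aX := hX.
pose N1 := mscale (-1)%:C%C mone.
have aN1 : madj N1 = N1 by rewrite /N1 madjZ madj_mone conjc_real.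
have mN1 A : mmul N1 A = mscale (-1)%:C%C A by rewrite mmulZl mmul1m.
have mN1r A : mmul A N1 = mscale (-1)%:C%C A by rewrite mmulZr mmulm1.
have [K1 K10 h1] := rip_exp_so_remainder mone (mmul X X) lL.
have [K2 K20 h2] := rip_exp_so_remainder X X lL.
have [K3 K30 h3] := rip_exp_so_remainder (mmul X X) mone lL.
have XX : rip (mmul X X) mone = rip X X by rewrite rip_mone1 Re_trmul_hermitian.
(* With [L mone = mzero] as well, both diagonal blocks lose their first-order term, so only the two
   cross terms contribute one. *)
have LXX : rip (L (mmul X X)) mone = 0 by rewrite rip_mone1 mtr_generator.
suff : 0 <= - rip (L X) X *+ 2 by rewrite pmulrn_lge0.
apply: (@linear_term_ge0 _ _ (K1 + K2 *+ 2 + K3)).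
  by rewrite !addr_ge0 // mulrn_wge0.
move=> t t01; have /andP[t0 _] := t01; have [cp _] := LT t t0.
have := rip_block_test (block2 mone X) (block2 X N1) cp.
rewrite !big_ord_recl !big_ord0 /block2 /= !addr0 madj_mone aX aN1 !mmul1m !mmulm1 !mN1 !mN1r.
rewrite !ripZr.
have := h1 t t01; have := h2 t t01; have := h3 t t01.
rewrite !ler_norml L1 rip_mone1 rip0l.
rewrite LXX [rip mone _]ripC XX.
set a := Re _; set b := rip (exp_so L t X) X; set c := rip (exp_so L t mone) _.
move=> /andP[? ?] /andP[? ?] /andP[? ?]; rewrite !mulr2n; lra.
Qed.

(** * Nonnegativity of the entropy *)

Lemma mmul_mdiag (U W : mat) (v : I -> C) i j :
  mmul (mmul U (mdiag v)) W i j = \sum_k U i k * v k * W k j.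
Proof.
apply: eq_bigr => k _; congr (_ * _).
rewrite /mmul (bigD1 k) //= big1 ?addr0 => [|l lk].
  by rewrite /mdiag eqxx mul1r.
by rewrite /mdiag (negPf lk) mul0r mulr0.
Qed.

(** Existence guarantees that the pair chosen by [epsilon] in [mfun] really diagonalizes [A]. The
    spectral theorem is transported along the enumeration of [I]. *)
Lemma spectral_decomposition (A : mat) : hermitian A -> exists p, spec_decomp A p.
Proof.
move=> hA; pose M : 'M[C]_#|I| := \matrix_(i, j) A (enum_val i) (enum_val j).
have hM : M \is hermsymmx.
  apply/is_hermitianmxP; rewrite expr0 scale1r; apply/matrixP => i j.
  by rewrite !mxE [LHS]hA.
have /orthomx_spectralP := hermitian_normalmx hM.
have := hermitian_spectral_diag_real hM.
move: (spectral_unitarymx M) => uP.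
rewrite invmx_unitary //; move: (spectralmx M) (spectral_diag M) uP => P D.
move=> /unitarymxP uP /mxOverP rD EM.
(* The matrix theorem puts the adjoint of [P] on the left of the diagonal, so the unitary is that
   adjoint; the eigenvalues are real, so [Re] loses nothing. *)
exists (fun i j => conjc (P (enum_rank j) (enum_rank i)), fun i => Re (D 0 (enum_rank i))).
split => /=.
  apply: mat_ext => i j; have := congr1 (fun B : 'M_ _ => B (enum_rank i) (enum_rank j)) uP.
  rewrite !mxE (reindex (@enum_rank I)) /=; last exact/onW_bij/enum_rank_bij.
  rewrite (inj_eq enum_rank_inj) /Defs.mone => <-; apply: eq_bigr => k _.
  by rewrite !mxE /madj conjcK.
apply: mat_ext => i j; rewrite mmul_mdiag.
have := congr1 (fun B : 'M_ _ => B (enum_rank i) (enum_rank j)) EM.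
rewrite /M !mxE !enum_rankK => ->.
rewrite (reindex (@enum_rank I)) /=; last exact/onW_bij/enum_rank_bij.
apply: eq_bigr => k _; rewrite /madj conjcK; congr (_ * _).
rewrite mul_mx_diag !mxE RRe_real //.
Qed.

Definition conj_diag (U : mat) (v : I -> C) : mat := mmul (mmul U (mdiag v)) (madj U).

Lemma mtr_conj_diag U v : unitary U -> mtr (conj_diag U v) = \sum_k v k.
Proof.
move=> uU; rewrite /conj_diag mtrC mmulA uU mmul1m.
by apply: eq_bigr => k _; rewrite /mdiag eqxx mul1r.
Qed.

Lemma mmul_conj_diag U v w : unitary U ->
  mmul (conj_diag U v) (conj_diag U w) = conj_diag U (fun k => v k * w k).
Proof.
move=> uU; rewrite /conj_diag [mmul _ (mmul (mmul U _) _)]mmulA.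
rewrite [mmul _ (mmul U _)]mmulA -[mmul (mmul _ (madj U)) U]mmulA uU mmulm1.
congr (mmul _ _); apply: mat_ext => i j; rewrite mmul_mdiag.
rewrite /mmul; apply: eq_bigr => k _; rewrite /mdiag.
by case: eqVneq => [->|]; rewrite ?mul1r ?mul0r ?mulr0 // mulrA.
Qed.

(** The [k]-th column of [U] is a unit eigenvector for [v k]. This turns positivity of the form into
    positivity of the eigenvalues. *)
Lemma qform_conj_diag U v k : unitary U ->
  qform (conj_diag U v) (fun i => U i k) = v k.
Proof.
move=> uU; rewrite (_ : qform _ _ = mmul (mmul (madj U) (conj_diag U v)) U k k).
  rewrite /conj_diag [mmul (madj U) _]mmulA [mmul (madj U) (mmul U _)]mmulA uU mmul1m.
  by rewrite -mmulA uU mmulm1 /mdiag eqxx mul1r.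
rewrite /qform /mmul exchange_big; apply: eq_bigr => j _ /=.
by rewrite mulr_suml.
Qed.

Lemma qform_sqr_ge0 (X : mat) v : hermitian X -> 0 <= qform (mmul X X) v.
Proof.
move=> hX; rewrite (_ : qform _ _ =
  \sum_m conjc (\sum_j X m j * v j) * (\sum_j X m j * v j)).
  by apply: sumr_ge0 => m _; rewrite mulrC mulcJ_ge0.
rewrite /qform /mmul.
under eq_bigr => p _ do under eq_bigr => q _ do rewrite mulr_sumr mulr_suml.
under eq_bigr => p _ do rewrite exchange_big /=.
rewrite exchange_big /=; apply: eq_bigr => k _.
rewrite rmorph_sum mulr_suml; apply: eq_bigr => p _.
rewrite mulr_sumr; apply: eq_bigr => q _.
by rewrite /= conjcM -hX; ring.
Qed.

Lemma hermitian_sqr (X : mat) : hermitian X -> hermitian (mmul X X).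
Proof.
move=> hX i j; rewrite rmorph_sum; apply: eq_bigr => k _.
by rewrite /= conjcM -!hX mulrC.
Qed.

Lemma mtr_sqr (X : mat) : hermitian X -> mtr (mmul X X) = (rip X X)%:C%C.
Proof.
move=> hX; rewrite -Re_trmul_hermitian //.
have := hermitian_mtr (hermitian_sqr hX).
by case: (mtr _) => a b [] b0; apply: complex_ext => //=; lra.
Qed.

(* [x ln x + x ln D >= x - 1/D], also at [x = 0] where [ln 0 = 0]. *)
Lemma xlnx_ge (x D : R) : 0 < D -> 0 <= x -> x - D^-1 <= x * ln x + x * ln D.
Proof.
move=> D0; rewrite le_eqVlt => /orP[/eqP <-|x0].
  by rewrite !mul0r addr0 sub0r oppr_le0 invr_ge0 ltW.
have xD : 0 < x * D by rewrite mulr_gt0.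
have : ln (1 + ((x * D)^-1 - 1)) <= (x * D)^-1 - 1.
  by apply: le_ln1Dx; rewrite ltrBrDl subrr invr_gt0.
rewrite addrC subrK lnV ?posrE // lnM ?posrE // => h.
rewrite -mulrDr -ler_pdivrMl //.
rewrite (_ : x^-1 * (x - D^-1) = 1 - (x * D)^-1); last by field; rewrite !gt_eqF.
lra.
Qed.

(** The eigenvalues [s] of [X^2 / tr X^2] form a probability vector, and up to a nonnegative factor
    [ent2 X] is its relative entropy to the uniform one, the sum of [s ln s] plus [ln D]. *)
Lemma ent2_ge0 (X : mat) : (0 < #|I|)%N -> hermitian X -> 0 <= ent2 X.
Proof.
move=> I0 hX; rewrite /ent2 divr_ge0 //; last by rewrite mulr_ge0 ?dimD_ge0.
have D0 : 0 < dimD R I by rewrite /dimD ltr0n.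
rewrite mtr_sqr //; set t := rip X X.
have [t0|tn] := eqVneq t 0.
  rewrite (rip_eq0 t0) (_ : mmul (mmul _ _) _ = mzero).
    by rewrite /mtr /Defs.mzero big1.
  apply: mat_ext => i j; rewrite /mmul big1 // => k _.
  by rewrite big1 ?mul0r // => l _; rewrite /Defs.mzero mul0r.
have tgt : 0 < t by rewrite lt_neqAle eq_sym tn rip_ge0.
have tC : t%:C%C != 0 by rewrite fmorph_eq0.
set sigma := mscale _ _.
have hs : hermitian sigma.
  move=> i j; rewrite /sigma /mscale conjcM -hermitian_sqr //.
  by rewrite conjc_inv conjc_real.
have XE : mmul X X = mscale t%:C%C sigma.
  by apply: mat_ext => i j; rewrite /sigma /mscale mulrA divff // mul1r.
rewrite /mlog /mfun.
(* The argument works with whichever decomposition is chosen. *)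
have := epsilon_spec (inhabits (mzero, fun _ => 0)) (spec_decomp sigma)
  (spectral_decomposition hs).
move: (epsilon _ _) => [U s] /= [uU sE].
rewrite XE mmulZl mtrZ mmulDr mtrD mmulZr mtrZ mmulm1 {1}sE.
rewrite -!/(conj_diag _ _) mmul_conj_diag // mtr_conj_diag //.
have s1 : \sum_k s k = 1.
  have : mtr sigma = 1 by rewrite mtrZ mtr_sqr // mulVf.
  rewrite sE mtr_conj_diag // => /(congr1 (@complex.Re R)); rewrite Re_sum => h; exact: h.
have s0 k : 0 <= s k.
  have : 0 <= qform sigma (fun i => U i k).
    rewrite (_ : qform _ _ = (t%:C%C)^-1 * qform (mmul X X) (fun i => U i k)).
      by rewrite mulr_ge0 ?qform_sqr_ge0 // invr_ge0 ler0c ltW.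
    rewrite /qform mulr_sumr; apply: eq_bigr => i _; rewrite mulr_sumr.
    by apply: eq_bigr => j _; rewrite /sigma /mscale; ring.
  by rewrite sE qform_conj_diag // ler0c.
have -> : mtr sigma = 1 by rewrite mtrZ mtr_sqr // mulVf.
rewrite mulr1 cReM /= mul0r subr0 mulr_ge0 ?rip_ge0 // cReD Re_sum /=.
have : \sum_k (s k - (dimD R I)^-1) <= \sum_k (s k * ln (s k) + s k * ln (dimD R I)).
  by apply: ler_sum => k _; apply: xlnx_ge.
(* The lower bounds [s k - 1/D] add up to [1 - 1 = 0]. *)
rewrite sumrB s1 sumr_const -[_ *+ _]mulr_natl divff ?gt_eqF // subrr.
rewrite big_split /= -mulr_suml s1 mul1r => /le_trans; apply.
rewrite lerD2r; apply: ler_sum => k _; rewrite mulr0 subr0 //.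
Qed.

End Superoperators.

(** * Tensor powers *)

Section Amplification.
Variables (R : realType) (n d : nat).
Local Notation config := {ffun 'I_n -> 'I_d}.
Local Notation C := R[i].
Local Notation Re := complex.Re.
Local Notation Im := complex.Im.

Lemma upd_upd (a : config) s p q : upd (upd a s p) s q = upd a s q.
Proof. by apply/ffunP => j; rewrite !ffunE; case: eqP. Qed.

Lemma upd_site (a : config) s p : upd a s p s = p.
Proof. by rewrite ffunE eqxx. Qed.

Lemma upd_id (a : config) s : upd a s (a s) = a.
Proof. by apply/ffunP => j; rewrite ffunE; case: eqP => [->|]. Qed.

Lemma sum_upd (s : 'I_n) (G : config -> R) :
  \sum_a \sum_(p < d) G (upd a s p) = d%:R * \sum_a G a.
Proof.
(* [h] swaps the letter at site [s] with the spare letter; reindexing by this involution frees the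
   sum over the spare letter, which gives the factor [d]. *)
pose h (u : config * 'I_d) := (upd u.1 s u.2, u.1 s).
have hK : involutive h by move=> [a p]; rewrite /h /= upd_upd upd_id upd_site.
rewrite (pair_bigA _ (fun a p => G (upd a s p))) /=.
rewrite (eq_bigr (fun u => G (h u).1)) //.
rewrite -(reindex_inj (P := predT) (F := fun u => G u.1) (inv_inj hK)) /=.
rewrite -(pair_bigA _ (fun a p => G a)) /= mulr_sumr; apply: eq_bigr => a _.
by rewrite sumr_const card_ord mulr_natl.
Qed.

Definition site_block (X : mat R config) (s : 'I_n) (a b : config) : mat R 'I_d :=
  fun p q => X (upd a s p) (upd b s q).

Lemma sum_upd2 (s : 'I_n) (G : config -> config -> R) :
  \sum_a \sum_b \sum_(p < d) \sum_(q < d) G (upd a s p) (upd b s q) =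
  d%:R ^+ 2 * \sum_a \sum_b G a b.
Proof.
under eq_bigr do rewrite exchange_big /=.
under eq_bigr => a _ do under eq_bigr => p _ do rewrite (sum_upd s (G (upd a s p))).
by rewrite (sum_upd s (fun a => d%:R * \sum_b G a b)) -mulr_sumr mulrA expr2.
Qed.

(** A block depends on [a] and [b] only away from [s], so the sum over all [a], [b] counts it
    [d ^+ 2] times. *)
Lemma rip_on_site (L : superop R 'I_d) (X : mat R config) s :
  d%:R ^+ 2 * rip (on_site L s X) X =
  \sum_a \sum_b rip (L (site_block X s a b)) (site_block X s a b).
Proof.
rewrite /rip -(sum_upd2 s); apply: eq_bigr => a _; apply: eq_bigr => b _.
apply: eq_bigr => p _; apply: eq_bigr => q _.
rewrite /on_site !upd_site (_ : (fun _ _ => _) = site_block X s a b) //.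
by apply: mat_ext => p' q'; rewrite !upd_upd.
Qed.

Lemma rip_ampl (L : superop R 'I_d) (X : mat R config) :
  d%:R ^+ 2 * rip (ampl n L X) X =
  \sum_s \sum_a \sum_b rip (L (site_block X s a b)) (site_block X s a b).
Proof.
under [RHS]eq_bigr do rewrite -rip_on_site.
rewrite -mulr_sumr; congr (_ * _); rewrite exchange_big; apply: eq_bigr => a _ /=.
rewrite exchange_big; apply: eq_bigr => b _ /=.
by rewrite /ampl Re_sum Im_sum !mulr_suml -big_split.
Qed.

(** The one-site inequality is applied to each block. It is assumed for every [Y] because the blocks
    of a Hermitian [X] need not be Hermitian. *)
Lemma rip_ampl_le (c1 c2 : R) (L1 L2 : superop R 'I_d) (X : mat R config) :
  (0 < d)%N ->
  (forall Y, c1 * - rip (L1 Y) Y <= c2 * - rip (L2 Y) Y) ->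
  c1 * - rip (ampl n L1 X) X <= c2 * - rip (ampl n L2 X) X.
Proof.
move=> d0 h; have d2 : 0 < d%:R ^+ 2 :> R by rewrite exprn_gt0 // ltr0n.
have E c L : d%:R ^+ 2 * (c * - rip (ampl n L X) X) =
    \sum_s \sum_a \sum_b c * - rip (L (site_block X s a b)) (site_block X s a b).
  rewrite mulrCA mulrN rip_ampl -sumrN mulr_sumr; apply: eq_bigr => s _.
  rewrite -sumrN mulr_sumr; apply: eq_bigr => a _.
  by rewrite -sumrN mulr_sumr.
rewrite -(ler_pM2l d2) !E; apply: ler_sum => s _; apply: ler_sum => a _.
exact: ler_sum.
Qed.

Lemma rip_ampl_ge0 (L : superop R 'I_d) (X : mat R config) :
  (0 < d)%N -> (forall Y, 0 <= - rip (L Y) Y) -> 0 <= - rip (ampl n L X) X.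
Proof.
move=> d0 h; have := @rip_ampl_le 0 1 L L X d0; rewrite mul0r mul1r; apply=> Y.
by rewrite mul0r mul1r.
Qed.

End Amplification.

(** * Comparison of the LS-2 constants *)

Lemma alpha2_le (R : realType) (I : finType) (c1 c2 : R) (M1 M2 : superop R I) :
  (0 < #|I|)%N -> 0 <= c1 -> 0 <= c2 ->
  (forall X, 0 <= - rip (M1 X) X) ->
  (forall X, c1 * - rip (M1 X) X <= c2 * - rip (M2 X) X) ->
  c1 * alpha2 M1 <= c2 * alpha2 M2.
Proof.
move=> I0 c10 c20 M1_ge0 M12; rewrite /alpha2.
set S1 := (X in inf X); set S2 := (X in _ <= _ * inf X).
(* A lower bound for [S1] is required before [inf S1] can be compared with its elements. *)
have S1_ge0 r : S1 r -> 0 <= r.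
  move=> [X [[hX _] [_ ->]]].
  by apply: divr_ge0; rewrite ?ent2_ge0 // dirichletE // divr_ge0 ?dimD_ge0.
have S12 r : S2 r -> c1 * inf S1 <= c2 * r.
  move=> [X [pX [nX ->]]]; have [hX _] := pX.
  apply: (@le_trans _ _ (c1 * (dirichlet M1 X / ent2 X))).
    by rewrite ler_wpM2l //; apply: ge_inf; [exists 0 => r' /S1_ge0|exists X].
  (* Multiplying by this inverse keeps the order even if [ent2 X = 0], where the inverse is 0. *)
  have eX : 0 <= (ent2 X)^-1 by rewrite invr_ge0 ent2_ge0.
  have DX : 0 <= (dimD R I)^-1 by rewrite invr_ge0 dimD_ge0.
  rewrite [c1 * _]mulrA [c2 * _]mulrA; apply: (ler_wpM2r eX).
  rewrite !dirichletE // [c1 * _]mulrA [c2 * _]mulrA; apply: (ler_wpM2r DX).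
  exact: M12.
(* Both sets range over the same matrices, so they are empty together, as for [n = 0] or [d = 1];
   both infima are then 0. *)
have [[r2 Sr2]|/forallNP S20] := pselect (exists r, S2 r); last first.
  rewrite (_ : S2 = set0); last by rewrite -subset0 => r /S20.
  rewrite (_ : S1 = set0) ?inf0 ?mulr0 // -subset0 => r [X [pX [nX _]]].
  by apply: (S20 (dirichlet M2 X / ent2 X)); exists X.
(* The case [c2 = 0] is separated because the bound is otherwise divided by [c2]; there any element
   of [S2] suffices. *)
have := c20; rewrite le_eqVlt => /orP[/eqP c2E|c2gt].
  by have := S12 _ Sr2; rewrite -c2E !mul0r.
rewrite -ler_pdivrMl //; apply: lb_le_inf; first by exists r2.
by move=> r /S12; rewrite -ler_pdivrMl.
Qed.

Lemma opnorm_ge0 (R : realType) (I : finType) (T : superop R I) :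
  (0 < #|I|)%N -> linear_so T -> 0 <= opnorm T.
Proof.
move=> I0 lT; have := hsnorm_le_opnorm (@mone R I) lT.
have h0 : 0 < hsnorm (@mone R I).
  by rewrite hsnormE sqrtr_gt0 rip_mone1 mtr_mone /= /dimD ltr0n.
by move=> h; rewrite -(pmulr_lge0 _ h0); apply: le_trans h; apply: sqrtr_ge0.
Qed.

Theorem mainTheorem3 (R : realType) (d : nat) (L : superop R 'I_d) :
  (0 < d)%N ->
  liouvillian L -> doubly_stochastic L -> primitive L ->
  forall n : nat,
    alpha2 (ampl n L) <= opnorm (so_symm L) * alpha2 (ampl n (Ldep 'I_d)) /\
    spectral_gap L * alpha2 (ampl n (Ldep 'I_d)) <= alpha2 (ampl n L).
Proof.
move=> d0 LL L1 _ n; have [lL _] := LL.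
have I0 : (0 < #|'I_d|)%N by rewrite card_ord.
have J0 : (0 < #|{ffun 'I_n -> 'I_d}|)%N by rewrite card_ffun !card_ord expn_gt0 d0.
have trL := mtr_generator LL.
have hL X := generator_madj X LL.
have L_ge0 X := generator_dissipative LL L1 (X := X).
have gap0 := spectral_gap_ge0 L_ge0.
have dep0 (Y : mat R 'I_d) : 0 <= - rip (Ldep _ Y) Y by rewrite rip_Ldep ?rip_ge0.
have gap := gap_le I0 lL hL L_ge0.
(* The gap inequality extends nonnegativity from Hermitian matrices to all [Y], as the blocks
   require. *)
have Lge Y : 0 <= - rip (L Y) Y by apply: le_trans (gap Y); rewrite mulr_ge0.
(* With the factor 1 inserted, both bounds are instances of [alpha2_le], with constants
   [1, opnorm (so_symm L)] and [spectral_gap L, 1]. *)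
rewrite -[alpha2 (ampl n L)]mul1r; split.
  apply: alpha2_le => // [|X|X]; first exact/opnorm_ge0/so_symm_linear.
    exact: rip_ampl_ge0.
  by apply: rip_ampl_le => // Y; rewrite mul1r; apply: rip_le_opnorm.
apply: alpha2_le => // X; first exact: rip_ampl_ge0.
by apply: rip_ampl_le => // Y; rewrite mul1r.
Qed.
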